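(* A countable model $\langle M,\in^M\rangle$ of set theory embeds into another model $\langle N,\in^N\rangle$ of set theory if and only if the ordinals of $M$ map order-preservingly into the ordinals of $N$, i.e. there is a map $f:\mathrm{Ord}^M\to\mathrm{Ord}^N$ such that $\alpha<\beta$ in $\mathrm{Ord}^M$ implies $f(\alpha)<f(\beta)$ in $\mathrm{Ord}^N$.
   Context: A model of set theory is a first-order structure $\langle M,\in^M\rangle$ satisfying at least the Kripke–Platek axioms KP; it need not be well-founded. $N$ is not assumed countable. $\mathrm{Ord}^M$ denotes the linear order of the ordinals of $M$. $M$ embeds into $N$ if $M$ is isomorphic to an induced substructure of $N$, i.e. there is an injective $j:M\to N$ with $x\in^M y\iff j(x)\in^N j(y)$. All maps are external. *)

(* Defs.v *)
From mathcomp Require Import all_boot.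

Set Implicit Arguments.
Unset Strict Implicit.
Unset Printing Implicit Defensive.

(* First-order formulas in the language {∈, =}, with de Bruijn indices: under
   a quantifier, variable 0 is the bound variable and n.+1 is the outer n. *)
Inductive formula : Type :=
| FMem of nat & nat
| FEq of nat & nat
| FNot of formula
| FAnd of formula & formula
| FOr of formula & formula
| FImp of formula & formula
| FAll of formula
| FEx of formula.

(* Bounded quantification is ∀x (x ∈ y → φ) or ∃x (x ∈ y ∧ φ); the bound
   i.+1 is an outer variable, hence is distinct from x. *)
Inductive delta0 : formula -> Prop :=
| delta0_mem i j : delta0 (FMem i j)
| delta0_eq i j : delta0 (FEq i j)
| delta0_not p : delta0 p -> delta0 (FNot p)
| delta0_and p q : delta0 p -> delta0 q -> delta0 (FAnd p q)
| delta0_or p q : delta0 p -> delta0 q -> delta0 (FOr p q)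
| delta0_imp p q : delta0 p -> delta0 q -> delta0 (FImp p q)
| delta0_ball i p : delta0 p -> delta0 (FAll (FImp (FMem 0 i.+1) p))
| delta0_bex i p : delta0 p -> delta0 (FEx (FAnd (FMem 0 i.+1) p)).

Definition scons (M : Type) (x : M) (v : nat -> M) : nat -> M :=
  fun n => if n is k.+1 then v k else x.

Fixpoint sat (M : Type) (mem : M -> M -> Prop) (v : nat -> M) (p : formula) :
    Prop :=
  match p with
  | FMem i j => mem (v i) (v j)
  | FEq i j => v i = v j
  | FNot q => ~ sat mem v q
  | FAnd q r => sat mem v q /\ sat mem v r
  | FOr q r => sat mem v q \/ sat mem v r
  | FImp q r => sat mem v q -> sat mem v r
  | FAll q => forall x, sat mem (scons x v) q
  | FEx q => exists x, sat mem (scons x v) q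
  end.

(* Kripke–Platek set theory, without the axiom of infinity and with foundation
   for all formulas.  In the schemes the valuation v supplies the parameters;
   the bound set b of separation and of collection is not among them. *)
Record KP_model (M : Type) (mem : M -> M -> Prop) : Prop := {
  KP_nonempty : inhabited M;
  KP_extensionality :
    forall a b, (forall x, mem x a <-> mem x b) -> a = b;
  KP_foundation :
    forall (p : formula) (v : nat -> M),
      (exists x, sat mem (scons x v) p) ->
      exists x, sat mem (scons x v) p /\
        forall y, mem y x -> ~ sat mem (scons y v) p;
  KP_pairing :
    forall a b, exists c, forall x, mem x c <-> x = a \/ x = b;
  KP_union :
    forall a, exists b, forall x, mem x b <-> exists y, mem y a /\ mem x y;
  KP_separation :
    forall (p : formula) (v : nat -> M) (a : M), delta0 p ->
      exists b, forall x, mem x b <-> mem x a /\ sat mem (scons x v) p;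
  KP_collection :
    forall (p : formula) (v : nat -> M) (a : M), delta0 p ->
      (forall x, mem x a -> exists y, sat mem (scons y (scons x v)) p) ->
      exists b, forall x, mem x a ->
        exists y, mem y b /\ sat mem (scons y (scons x v)) p
}.

Definition transitive_set (M : Type) (mem : M -> M -> Prop) (a : M) : Prop :=
  forall x y, mem x a -> mem y x -> mem y a.

(* In the presence of foundation, a transitive set of transitive sets is
   linearly ordered by membership. *)
Definition is_ordinal (M : Type) (mem : M -> M -> Prop) (a : M) : Prop :=
  transitive_set mem a /\ forall x, mem x a -> transitive_set mem x.

Definition Ord (M : Type) (mem : M -> M -> Prop) : Type :=
  {a : M | is_ordinal mem a}.

Definition ord_lt (M : Type) (mem : M -> M -> Prop) (a b : Ord mem) : Prop :=
  mem (sval a) (sval b).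

Definition embeds (M N : Type) (memM : M -> M -> Prop)
    (memN : N -> N -> Prop) : Prop :=
  exists j : M -> N,
    injective j /\ forall x y, memM x y <-> memN (j x) (j y).

(* Main.v *)
(* If j embeds M into N, then alpha |-> rank^N(j alpha) is order preserving.

   Conversely let f : Ord^M -> Ord^N preserve <, put g(x) = f(rank^M x), and let
   e : M -> nat be injective.  Suppose first that some g(x) contains every
   standard numeral.  Then N has a set L of "labels" that contains every
   standard finite set of nonzero numerals.  Two labels are linked when the
   greatest element of one of them belongs to the other.  Give x the label
   l(x) = {e(x)+1} U {e(y)+1 : e(y) < e(x), y in x or x in y}: for x <> y, the
   labels of x and y are linked exactly when x in y or y in x.  By recursion
   on ordinals N defines
     J(b,l) = {b, l} U {J(a,l') : a in b, l' in L, l' linked to l},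
   and x |-> J(g(x), l(x)) is an embedding: g decides the direction of each
   link.  This is an (Ord x L)-graded variant of Hamkins' hypnagogic digraph
   whose predecessor classes are sets.  Suppose finally that no g(x) contains
   every numeral.  Then every g(x) is a standard numeral, every set of M has
   finitely many elements, and the embedding is built by recursion on nat. *)
Require Import Defs.
From mathcomp Require Import all_boot.
From mathcomp Require Import boolp classical_sets functions cardinality.

Set Implicit Arguments.
Unset Strict Implicit.
Unset Printing Implicit Defensive.

Local Open Scope classical_set_scope.

(** * Bounded formulas for the notions used below *)

(* Each formula F... below is such that its satisfaction is convertible to the
   predicate of the corresponding name (FOrd to [ordinal], FPair to [kpair],
   and so on), so schema instances are checked by [iff_refl]. *)
Definition FBall i p := FAll (FImp (FMem 0 i.+1) p).
Definition FBex i p := FEx (FAnd (FMem 0 i.+1) p).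

Definition FOrd i :=
  FAnd (FBall i (FBall 0 (FMem 0 i.+2)))
       (FBall i (FBall 0 (FBall 0 (FMem 0 2)))).

Definition FPair p y b :=
  let isy := FBall 0 (FEq 0 y.+2) in
  let isyb := FAnd (FMem b.+1 0) (FBall 0 (FOr (FEq 0 y.+2) (FEq 0 b.+2))) in
  FAnd (FBex p (FAnd (FMem y.+1 0) isy))
    (FAnd (FBex p (FAnd (FMem y.+1 0) isyb))
       (FBall p (FAnd (FMem y.+1 0) (FOr isy isyb)))).

Definition FRanking g :=
  FBall g (FBall 0 (FBall 0 (FBall 1 (FImp (FPair 3 1 0)
    (FAnd (FOrd 0) (FBall 1 (FBex 1 (FBex (g + 6) (FPair 0 2 1))))))))).

Definition FInsert z x y :=
  FAnd (FBall x (FMem 0 z.+1))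
    (FAnd (FMem y z) (FBall z (FOr (FMem 0 x.+1) (FEq 0 y.+1)))).

Definition FInsertClosed n w :=
  FAnd (FBex w (FBall 0 (FNot (FEq 0 0))))
    (FBall w (FBall n.+1 (FBex w.+2 (FInsert 0 2 1)))).

Definition FTop s i := FBall s (FOr (FEq 0 i.+1) (FMem 0 i.+1)).

Definition FLinked s t :=
  FBex s (FAnd (FMem 0 t.+1) (FOr (FTop s.+1 0) (FTop t.+1 0))).

Definition FNode T z L :=
  FBex z (FAnd (FOrd 0) (FBex z.+1 (FAnd (FMem 0 L.+2) (FAnd
    (FBall z.+2 (FOr (FEq 0 2) (FOr (FEq 0 1) (FAnd (FMem 0 T.+3)
       (FBex 0 (FAnd (FMem 0 3)
          (FBex 1 (FAnd (FMem 0 (L + 5)) (FLinked 0 3)))))))))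
    (FBall 1 (FBall L.+3 (FImp (FLinked 0 2)
       (FBex z.+4 (FAnd (FMem 0 (T + 5)) (FAnd (FMem 2 0) (FMem 1 0))))))))))).

Definition FNodes T L := FBall T (FNode T.+1 0 L.+1).

Definition FLevel T b L :=
  FAnd (FNodes T L)
    (FBall L (FBex T.+1 (FAnd (FMem b.+2 0) (FMem 1 0)))).

Ltac solve_delta0 := repeat constructor.

(** * Scheme instances and elementary set operations *)

Section KP.
Context (M : Type) (E : M -> M -> Prop) (KP : KP_model E).
Local Notation "x ∈ y" := (E x y) (at level 70).

(** Foundation applied to [FNot p]. It covers unbounded formulas, so induction applies to statements
    such as the existence of a level, while separation and collection need bounded ones. *)
Lemma set_induction (P : M -> Prop) p v :
  (forall x, sat E (scons x v) p <-> P x) ->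
  (forall x, (forall y, y ∈ x -> P y) -> P x) -> forall x, P x.
Proof.
move=> pP IH; apply: contrapT => /existsNP[x Px].
have [|y [yp ymin]] := KP_foundation KP (p := FNot p) (v := v).
  by exists x => /pP.
apply: yp; apply/pP/IH => z zy; apply/pP; apply: contrapT => zp.
exact: ymin zy zp.
Qed.

Lemma minimal_witness (P : M -> Prop) p v :
  (forall x, sat E (scons x v) p <-> P x) ->
  (exists x, P x) -> exists x, P x /\ forall y, y ∈ x -> ~ P y.
Proof.
move=> pP [x Px].
have [|y [yp ymin]] := KP_foundation KP (p := p) (v := v); first by exists x; apply/pP.
by exists y; split=> [|z zy /pP zp]; [apply/pP | apply: ymin zy zp].
Qed.

Lemma separation (P : M -> Prop) p v a :
  (forall x, sat E (scons x v) p <-> P x) -> delta0 p ->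
  exists b, forall x, x ∈ b <-> x ∈ a /\ P x.
Proof.
move=> pP /(KP_separation KP v a)[b bP]; exists b => x.
by rewrite bP pP.
Qed.

Lemma collection (R : M -> M -> Prop) p v a :
  (forall x y, sat E (scons y (scons x v)) p <-> R x y) -> delta0 p ->
  (forall x, x ∈ a -> exists y, R x y) ->
  exists b, forall x, x ∈ a -> exists y, y ∈ b /\ R x y.
Proof.
move=> pR dp aR.
have [x /aR[y /pR]|b bP] := KP_collection KP (v := v) (a := a) dp.
  by exists y.
by exists b => x /bP[y [yb /pR]]; exists y.
Qed.

Lemma empty_set : exists a, forall x, ~ x ∈ a.
Proof.
have [a] := KP_nonempty KP.
have [b bP] := separation (P := fun x => ~ x = x) (p := FNot (FEq 0 0))
  (v := fun=> a) a (fun=> iff_refl _) ltac:(solve_delta0).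
by exists b => x /bP[_].
Qed.

Lemma pairing a b : exists c, forall x, x ∈ c <-> x = a \/ x = b.
Proof. exact: KP_pairing. Qed.

Lemma binary_union a b : exists c, forall x, x ∈ c <-> x ∈ a \/ x ∈ b.
Proof.
have [d dP] := pairing a b; have [c cP] := KP_union KP d.
exists c => x; rewrite cP; split=> [[y [/dP[]-> ?]]|[?|?]]; first by left.
- by right.
- by exists a; split=> //; apply/dP; left.
- by exists b; split=> //; apply/dP; right.
Qed.

Lemma adjunction a b : exists c, forall x, x ∈ c <-> x ∈ a \/ x = b.
Proof.
have [s sP] := pairing b b; have [c cP] := binary_union a s.
by exists c => x; rewrite cP sP; tauto.
Qed.

(** * Membership and the linear order of the ordinals *)

Lemma mem_irrefl a : ~ a ∈ a.
Proof.
have v : nat -> M := fun=> a; move: a.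
apply: (set_induction (P := fun a => ~ a ∈ a) (p := FNot (FMem 0 0))
  (v := v)) => // a IH aa.
exact: (IH a).
Qed.

Lemma mem_asym a b : a ∈ b -> ~ b ∈ a.
Proof.
have v : nat -> M := fun=> a; move: a b.
apply: (set_induction (P := fun a => forall b, a ∈ b -> ~ b ∈ a)
  (p := FAll (FImp (FMem 1 0) (FNot (FMem 0 1)))) (v := v)) => //.
by move=> a IH b ab ba; exact: (IH b ba a ba ab).
Qed.

(* [is_ordinal] with its quantifiers in bounded form. *)
Definition ordinal a :=
  (forall x, x ∈ a -> forall y, y ∈ x -> y ∈ a) /\
  (forall x, x ∈ a -> forall y, y ∈ x -> forall z, z ∈ y -> z ∈ x).

Lemma ordinalP a : is_ordinal E a <-> ordinal a.
Proof.
split=> -[h1 h2]; split.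
- by move=> x xa y yx; exact: (h1 x).
- by move=> x xa y yx z zy; exact: (h2 x xa y).
- by move=> x y xa yx; exact: (h1 x).
- by move=> x xa y z yx zy; exact: (h2 x xa y).
Qed.

Lemma mem_ordinal a x : ordinal a -> x ∈ a -> ordinal x.
Proof.
move=> [h1 h2] xa; split; first exact: h2.
by move=> y yx; apply: h2; exact: (h1 x).
Qed.

Lemma ordinal_trans a x y : ordinal a -> x ∈ a -> y ∈ x -> y ∈ a.
Proof. by move=> [+ _] => /[apply]; exact. Qed.

(** Induction on [a] and, inside it, on [b]: if neither contains the other, the two hypotheses show
    that they have the same elements. *)
Lemma ordinal_trichotomy a b : ordinal a -> ordinal b ->
  a ∈ b \/ a = b \/ b ∈ a.
Proof.
have v : nat -> M := fun=> a; move=> + ob; move: a b ob.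
pose cmp := FOr (FMem 1 0) (FOr (FEq 1 0) (FMem 0 1)).
pose P a := ordinal a -> forall b, ordinal b -> a ∈ b \/ a = b \/ b ∈ a.
suff: forall a, P a by move=> + a b ob oa => /(_ a oa b ob).
apply: (set_induction (P := P)
  (p := FImp (FOrd 0) (FAll (FImp (FOrd 0) cmp))) (v := v)) => // a IHa oa.
apply: (set_induction (P := fun b => ordinal b -> a ∈ b \/ a = b \/ b ∈ a)
  (p := FImp (FOrd 0) cmp) (v := fun=> a)) => // b IHb ob.
apply: contrapT => ncmp; apply: (ncmp); right; left.
apply: (KP_extensionality KP) => x; split=> [xa|xb].
- have [//|[xb|bx]] := IHa _ xa (mem_ordinal oa xa) b ob.
    by case: ncmp; right; right; rewrite -xb.
  by case: ncmp; right; right; exact: ordinal_trans xa bx.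
- have [ax|[ax|//]] := IHb _ xb (mem_ordinal ob xb).
    by case: ncmp; left; exact: ordinal_trans xb ax.
  by case: ncmp; left; rewrite ax.
Qed.

Lemma ordinal_empty_mem a e : (forall x, ~ x ∈ e) -> ordinal a ->
  a = e \/ e ∈ a.
Proof.
move=> e0 oa; have oe : ordinal e by split=> x /e0.
by have [/e0|[]] := ordinal_trichotomy oa oe; [|left|right].
Qed.

(** * Ordered pairs and ranks *)

(** The Kuratowski pair {{y}, {y, b}}, described through its elements so that all quantifiers are
    bounded. *)
Definition kpair p y b :=
  (exists u, u ∈ p /\ (y ∈ u /\ forall t, t ∈ u -> t = y)) /\
  (exists u, u ∈ p /\ (y ∈ u /\ (b ∈ u /\ forall t, t ∈ u -> t = y \/ t = b))) /\
  (forall u, u ∈ p -> y ∈ u /\ ((forall t, t ∈ u -> t = y) \/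
     (b ∈ u /\ forall t, t ∈ u -> t = y \/ t = b))).

Lemma kpair_exists y b : exists p, kpair p y b.
Proof.
have [u uP] := pairing y y; have [w wP] := pairing y b.
have [p pP] := pairing u w; exists p; split; last split.
- exists u; split; first by apply/pP; left.
  by split=> [|t /uP[]//]; apply/uP; left.
- exists w; split; first by apply/pP; right.
  by split; [apply/wP; left | split=> [|t /wP//]; apply/wP; right].
- move=> t /pP[]->; first by split; [apply/uP; left | left=> x /uP[]].
  by split; [|right; split=> [|x /wP//]]; apply/wP; [left | right].
Qed.

Lemma kpair_inj p y b y' b' : kpair p y b -> kpair p y' b' -> y = y' /\ b = b'.
Proof.
move=> [[u [up [yu uy]]] [[w [wp [yw [bw wyb]]]] pyb]].
move=> [_ [[w' [wp' [yw' [bw' wyb']]]] pyb']].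
have yy' : y' = y by apply: uy; case: (pyb' _ up).
move: yw' wyb' pyb'; rewrite yy' => yw' wyb' pyb'; split=> //.
have [_ [wy|[bw'' wyb'']]] := pyb' _ wp.
  have byE := wy _ bw; have [_ [wy'|[_ wy']]] := pyb _ wp'.
    by rewrite byE (wy' _ bw').
  by case: (wy' _ bw') => ->.
have [bE|//] := wyb'' _ bw; have [b'E|//] := wyb _ bw''.
by rewrite bE b'E.
Qed.

Definition ranking g :=
  forall p, p ∈ g -> forall u, u ∈ p -> forall y, y ∈ u -> forall b, b ∈ u ->
  kpair p y b -> ordinal b /\
    forall z, z ∈ y -> exists c, c ∈ b /\ exists q, q ∈ g /\ kpair q z c.

(* Ranks are obtained as least bounds, so a ranking, a relation given as a set
   of pairs, need be neither single-valued nor optimal. *)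
Definition rank_bound x a :=
  exists g, ranking g /\ exists p, p ∈ g /\ kpair p x a.

Lemma rank_bound_ordinal x a : rank_bound x a -> ordinal a.
Proof.
move=> [g [rg [p [pg pxa]]]]; have [_ [[u [up [xu [au _]]]] _]] := pxa.
by have [] := rg p pg u up x xu a au pxa.
Qed.

Lemma rank_bound_mem x y a : rank_bound y a -> x ∈ y ->
  exists b, b ∈ a /\ rank_bound x b.
Proof.
move=> [g [rg [p [pg pya]]]] xy; have [_ [[u [up [yu [au _]]]] _]] := pya.
have [_ /(_ x xy)[b [ba gxb]]] := rg p pg u up y yu a au pya.
by exists b; split=> //; exists g.
Qed.

(** Take d together with its union: d makes the bound strict, the union makes it transitive. *)
Lemma ordinal_strict_sup d : (forall a, a ∈ d -> ordinal a) ->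
  exists b, ordinal b /\ forall a, a ∈ d -> a ∈ b.
Proof.
move=> od; have [s sP] := KP_union KP d; have [b bP] := binary_union d s.
have ob a : a ∈ b -> ordinal a.
  by move=> /bP[/od//|/sP[y [/od oy]]]; exact: mem_ordinal.
exists b; split=> [|a ad]; last by apply/bP; left.
split=> [x xb y yx|x /ob[]//].
move/bP: xb => [xd|/sP[z [zd xz]]]; apply/bP; right; apply/sP.
  by exists x.
by exists z; split=> //; exact: ordinal_trans (od _ zd) xz yx.
Qed.

(** Rankings for the elements of [x] are collected and united; then a pair (x, l) is added, with l
    above every ordinal occurring in their pairs. *)
Lemma rank_bound_exists x : exists a, rank_bound x a.
Proof.
have v : nat -> M := fun=> x; move: x.
apply: (set_induction (P := fun x => exists a, rank_bound x a)
  (p := FEx (FEx (FAnd (FRanking 0) (FBex 0 (FPair 0 3 2))))) (v := v)) => //.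
move=> x IH.
have [B BP] := collection (R := fun z g => ranking g /\ exists p, p ∈ g /\
    exists u, u ∈ p /\ exists a, a ∈ u /\ kpair p z a)
  (p := FAnd (FRanking 0) (FBex 0 (FBex 0 (FBex 0 (FPair 2 4 0))))) (v := v)
  (a := x) (fun _ _ => iff_refl _) ltac:(solve_delta0) ltac:(
  by move=> z /IH[a [g [rg [p [pg pza]]]]]; exists g; split=> //; exists p;
    split=> //; have [_ [[u [up [_ [au _]]]] _]] := pza; exists u; split=> //;
    exists a).
(* Collection may return unwanted members, so only the rankings are kept. *)
have [B' B'P] := separation (P := ranking) (p := FRanking 0) (v := v) B
  (fun=> iff_refl _) ltac:(solve_delta0).
(* Three unions lead from rankings to pairs, to their elements, to the components. *)
have [G GP] := KP_union KP B'; have [G1 G1P] := KP_union KP G.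
have [G2 G2P] := KP_union KP G1.
have [d dP] := separation (P := ordinal) (p := FOrd 0) (v := v) G2
  (fun=> iff_refl _) ltac:(solve_delta0).
have [|l [ol dl]] := @ordinal_strict_sup d; first by move=> a /dP[].
have [p pxl] := kpair_exists x l; have [g gP] := adjunction G p.
exists l, g; split; last by exists p; split=> //; apply/gP; right.
move=> q /gP[/GP[h [hB' qh]]|->] u uq y yu b bu qyb.
  have [_ rh] := (B'P h).1 hB'.
  have [ob yb] := rh q qh u uq y yu b bu qyb; split=> // z /yb[c [cb [r [rh' rzc]]]].
  by exists c; split=> //; exists r; split=> //; apply/gP; left; apply/GP; exists h.
have [<- <-] := kpair_inj pxl qyb; split=> // z /BP[h [hB [rh [r [rh' [w [wr [a [aw rza]]]]]]]]].
have rG : r ∈ G by apply/GP; exists h; split=> //; apply/B'P.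
exists a; split; last by exists r; split=> //; apply/gP; left.
apply: dl; apply/dP; split.
  by apply/G2P; exists w; split=> //; apply/G1P; exists r.
by apply: (@rank_bound_ordinal z); exists h; split=> //; exists r.
Qed.

(** The rank is the least rank bound. For x in y, [rk y] contains a bound of x, and [rk x] is at
    most that bound by minimality. *)
Lemma rank_exists : exists rk : M -> M,
  (forall x, ordinal (rk x)) /\ forall x y, x ∈ y -> rk x ∈ rk y.
Proof.
have least x : exists a, rank_bound x a /\ forall b, b ∈ a -> ~ rank_bound x b.
  exact: (minimal_witness (P := rank_bound x)
    (p := FEx (FAnd (FRanking 0) (FBex 0 (FPair 0 3 2))))
    (v := fun=> x) (fun=> iff_refl _) (rank_bound_exists x)).
have [rk rkP] := choice least; exists rk; split=> [x|x y xy].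
  by apply: (@rank_bound_ordinal x); case: (rkP x).
have [rby ymin] := rkP y; have [rbx xmin] := rkP x.
have oy := rank_bound_ordinal rby; have ox := rank_bound_ordinal rbx.
have [b [bry bxb]] := rank_bound_mem rby xy.
have [rxb|[->//|brx]] := ordinal_trichotomy ox (mem_ordinal oy bry).
  exact: ordinal_trans oy bry rxb.
by have := xmin _ brx.
Qed.

(** * Standard numerals and finite sets of them *)

Lemma numerals_exist : exists num : nat -> M,
  (forall x, ~ x ∈ num 0) /\
  forall i x, x ∈ num i.+1 <-> x ∈ num i \/ x = num i.
Proof.
have [e e0] := empty_set; have [S SP] := choice (fun a => adjunction a a).
by exists (fun i => iter i S e); split=> // i x; rewrite iterS SP.
Qed.

Definition insert_of z x y :=
  (forall t, t ∈ x -> t ∈ z) /\ (y ∈ z /\ forall t, t ∈ z -> t ∈ x \/ t = y).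

(** Such a [w] contains every standard finite subset of [n]; it replaces the power set, which KP
    does not provide. *)
Definition insert_closed n w :=
  (exists e, e ∈ w /\ forall x, x ∈ e -> ~ x = x) /\
  forall x, x ∈ w -> forall y, y ∈ n -> exists z, z ∈ w /\ insert_of z x y.

Section Numerals.
Context (num : nat -> M) (num0 : forall x, ~ x ∈ num 0)
  (numS : forall i x, x ∈ num i.+1 <-> x ∈ num i \/ x = num i).

Lemma mem_numP j x : x ∈ num j <-> exists i, i < j /\ x = num i.
Proof.
elim: j => [|j IH]; first by split=> [/num0|[i []]].
rewrite numS IH; split=> [[[i [ij ->]]|->]|[i []]].
- by exists i; split=> //; apply: ltnW.
- by exists j.
- by rewrite ltnS leq_eqVlt => /orP[/eqP->|]; [right | left; exists i].
Qed.

Lemma num_ordinal i : ordinal (num i).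
Proof.
split=> [x /mem_numP[j [ji ->]] y /mem_numP[k [kj ->]]|].
  by apply/mem_numP; exists k; split=> //; exact: ltn_trans kj ji.
move=> x /mem_numP[j [ji ->]] y /mem_numP[k [kj ->]] z /mem_numP[l [lk ->]].
by apply/mem_numP; exists l; split=> //; exact: ltn_trans lk kj.
Qed.

Lemma num_lt i j : num i ∈ num j <-> i < j.
Proof.
split=> [ij|ij]; last by apply/mem_numP; exists i.
have [//|ji|ijE] := ltngtP i j; last by case: (@mem_irrefl (num i)); rewrite {2}ijE.
by case: (mem_asym ij); apply/mem_numP; exists j.
Qed.

Lemma num_inj : injective num.
Proof.
move=> i j ij; have [/num_lt|/num_lt|//] := ltngtP i j;
  by rewrite ij => /mem_irrefl.
Qed.

(** By trichotomy, an ordinal that is no numeral contains zero and the successor of each numeral in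
    it. *)
Lemma ordinal_num_or n : ordinal n ->
  (exists i, n = num i) \/ forall i, num i ∈ n.
Proof.
move=> on; have [?|nn] := pselect (exists i, n = num i); [by left | right].
have ne i : n <> num i by move=> ni; apply: nn; exists i.
elim=> [|i IH]; first by have [/ne|] := ordinal_empty_mem num0 on.
have [/numS[/(mem_asym IH)//|/ne//]|[/ne//|//]] :=
  ordinal_trichotomy on (num_ordinal i.+1).
Qed.

(** Induction: to a set closed for [num i], add the results of inserting [num i] into its
    members. *)
Lemma insert_closed_num i : exists w, insert_closed (num i) w.
Proof.
elim: i => [|i [w [[e [ew e0]] wP]]].
  have [w wP] := pairing (num 0) (num 0); exists w; split=> [|x _ y /num0//].
  by exists (num 0); split=> [|x /num0//]; apply/wP; left.
have ins x a : exists z, insert_of z x a.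
  have [z zP] := adjunction x a; exists z.
  split=> [t tx|]; first by apply/zP; left.
  by split=> [|t /zP//]; apply/zP; right.
have [B BP] := collection (R := fun x z => insert_of z x (num i))
  (p := FInsert 0 1 2) (v := fun=> num i) (a := w) (fun _ _ => iff_refl _)
  ltac:(solve_delta0) (fun x _ => ins x (num i)).
have [C CP] := separation
  (P := fun z => exists x, x ∈ w /\ insert_of z x (num i))
  (p := FBex 1 (FInsert 1 0 3)) (v := scons w (fun=> num i)) B
  (fun=> iff_refl _) ltac:(solve_delta0).
have [w' w'P] := binary_union w C; exists w'; split.
  by exists e; split=> //; apply/w'P; left.
move=> x /w'P[xw|/CP[xB [x0 [x0w [x0x [ix xx0]]]]]] y /numS[yi|->].
- by have [z [zw ?]] := wP x xw y yi; exists z; split=> //; apply/w'P; left.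
- have [z [zB zx]] := BP x xw; exists z; split=> //; apply/w'P; right.
  by apply/CP; split=> //; exists x.
(* Insertions commute: [y] is first inserted into [x0] within [w], then [num i]. *)
- have [z0 [z0w [x0z0 [yz0 z0P]]]] := wP x0 x0w y yi.
  have [z [zB [z0z [iz zP]]]] := BP z0 z0w; exists z; split.
    by apply/w'P; right; apply/CP; split=> //; exists z0.
  split=> [t /xx0[/x0z0/z0z//|->//]|]; split=> [|t /zP[/z0P[/x0x|]|->]]; auto.
- exists x; split; first by apply/w'P; right; apply/CP; split=> //; exists x0.
  by split=> //; split=> // t; left.
Qed.

(* U collects the sets that are closed under insertion of elements of x, for
   x in m, where m is the least ordinal that has no such set, if there is one:
   m is then not a numeral, hence contains them all. *)
Lemma finite_subsets_cover n : ordinal n -> (forall i, num i ∈ n) ->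
  exists U, forall k (D : nat -> Prop), exists s, s ∈ U /\
    forall x, x ∈ s <-> exists i, i < k /\ D i /\ x = num i.
Proof.
move=> on nn.
have [m [om [nm mP]]] : exists m, ordinal m /\ (forall i, num i ∈ m) /\
    forall x, x ∈ m -> exists w, insert_closed x w.
  have [bad|nbad] :=
    pselect (exists m, ordinal m /\ ~ exists w, insert_closed m w).
    have [m [[om mbad] mmin]] := minimal_witness
      (P := fun m => ordinal m /\ ~ exists w, insert_closed m w)
      (p := FAnd (FOrd 0) (FNot (FEx (FInsertClosed 1 0)))) (v := fun=> n)
      (fun=> iff_refl _) bad.
    exists m; split=> //; split=> [|x xm].
      have [[i mi]|//] := ordinal_num_or om.
      by case: mbad; rewrite mi; exact: insert_closed_num.
    apply: contrapT => xbad; apply: (mmin x xm); split=> //.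
    exact: mem_ordinal xm.
  exists n; do 2!split=> //; move=> x xn; apply: contrapT => xbad.
  by apply: nbad; exists x; split=> //; exact: mem_ordinal xn.
have [B BP] := collection (R := insert_closed) (p := FInsertClosed 1 0)
  (v := fun=> m) (fun _ _ => iff_refl _) ltac:(solve_delta0) mP.
have [U UP] := KP_union KP B; exists U => k D.
have [w [wB [[e [ew e0]] wP]]] := BP _ (nm k).
suff [s [sw sP]] : exists s, s ∈ w /\
    forall x, x ∈ s <-> exists i, i < k /\ D i /\ x = num i.
  by exists s; split=> //; apply/UP; exists w.
(* Only the bound on i varies in the induction; [w] remains the set for [num k]. *)
elim: {-2}k (leqnn k) => [_|l IH lk].
  by exists e; split=> // x; split=> [/e0|[i []]].
have [s [sw sP]] := IH (ltnW lk).
have step x : (exists i, i < l.+1 /\ D i /\ x = num i) <->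
    x ∈ s \/ (D l /\ x = num l).
  rewrite sP; split=> [[i [il [Di xi]]]|[[i [il ?]]|?]]; last by exists l.
    move: il; rewrite ltnS leq_eqVlt => /orP[/eqP il|il]; last by left; exists i.
    by right; rewrite -il.
  by exists i; split=> //; exact: ltnW.
have [Dl|nDl] := pselect (D l); last by exists s; split=> // x; rewrite step; tauto.
have [z [zw [sz [lz zP]]]] := wP s sw (num l) ((num_lt l k).2 lk).
exists z; split=> // x; rewrite step; split=> [/zP|[/sz//|[_ ->//]]]; tauto.
Qed.

End Numerals.

(** * Labels, links and the graded recursion *)

Definition top s i := forall k, k ∈ s -> k = i \/ k ∈ i.

Definition linked s t :=
  exists i, i ∈ s /\ (i ∈ t /\ (top s i \/ top t i)).

Section Nodes.
Context (L : M) (L_not_ordinal : forall l, l ∈ L -> ~ ordinal l)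
  (L_ordinals : forall l t, l ∈ L -> t ∈ l -> ordinal t).

(* [node T z] states z = J(b,l), the values J(a,l') being taken in T.  An
   element of [nodes] is neither an ordinal nor a label, so b and l can be read
   off z as its only ordinal and its only label; no ordered pairs are needed. *)
Definition node T z :=
  exists b, b ∈ z /\ (ordinal b /\ exists l, l ∈ z /\ (l ∈ L /\
   ((forall w, w ∈ z -> w = b \/ (w = l \/ (w ∈ T /\
       exists a, a ∈ w /\ (a ∈ b /\
         exists l', l' ∈ w /\ (l' ∈ L /\ linked l' l))))) /\
    (forall a, a ∈ b -> forall l', l' ∈ L -> linked l' l ->
       exists w, w ∈ z /\ (w ∈ T /\ (a ∈ w /\ l' ∈ w)))))).

Definition nodes T := forall z, z ∈ T -> node T z.

(** A level also carries lower nodes, since [node T z] takes them from [T]. *)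
Definition level T b :=
  nodes T /\ forall l, l ∈ L -> exists z, z ∈ T /\ (b ∈ z /\ l ∈ z).

Lemma node_sub T T' z : (forall x, x ∈ T -> x ∈ T') -> node T z -> node T' z.
Proof.
move=> TT' [b [bz [ob [l [lz [lL [zP zE]]]]]]].
exists b; split=> //; split=> //; exists l; do 2![split=> //]; split=> [w|].
  by move=> /zP[|[|[wT ?]]]; [left | right; left | right; right; split; auto].
move=> a ab l' l'L l'l; have [w [wz [wT ?]]] := zE a ab l' l'L l'l.
by exists w; split=> //; split=> //; exact: TT'.
Qed.

(** Induction on [b]: levels for all a in b are collected and united, then a node of ordinal [b] is
    added for each label. *)
Lemma level_exists b : ordinal b -> exists T, level T b.
Proof.
move: b; apply: (set_induction (P := fun b => ordinal b -> exists T, level T b)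
  (p := FImp (FOrd 0) (FEx (FLevel 0 1 2))) (v := fun=> L)) => // b IH ob.
have [B BP] := collection (R := fun a T => level T a) (p := FLevel 0 1 2)
  (v := fun=> L) (a := b) (fun _ _ => iff_refl _) ltac:(solve_delta0)
  (fun a ab => IH a ab (mem_ordinal ob ab)).
have [B' B'P] := separation (P := nodes) (p := FNodes 0 1) (v := fun=> L) B
  (fun=> iff_refl _) ltac:(solve_delta0).
have [T TP] := KP_union KP B'.
have nT : nodes T.
  move=> z /TP[S [SB zS]]; have [_ /(_ z zS)] := (B'P S).1 SB.
  by apply: node_sub => x xS; apply/TP; exists S.
have extend l : l ∈ L -> exists z, node T z /\ (b ∈ z /\ l ∈ z).
  (* [W] gathers the lower nodes whose label is linked to [l]; adding [b] and [l] gives J(b,l). *)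
  move=> lL; have [W WP] := separation
    (P := fun w => exists a, a ∈ w /\ (a ∈ b /\
           exists l', l' ∈ w /\ (l' ∈ L /\ linked l' l)))
    (p := FBex 0 (FAnd (FMem 0 2) (FBex 1 (FAnd (FMem 0 5) (FLinked 0 4)))))
    (v := scons b (scons l (fun=> L))) T (fun=> iff_refl _) ltac:(solve_delta0).
  have [Wb WbP] := adjunction W b; have [z zP] := adjunction Wb l.
  have bz : b ∈ z by apply/zP; left; apply/WbP; right.
  have lz : l ∈ z by apply/zP; right.
  exists z; split=> //; exists b; split=> //; split=> //; exists l.
  do 2!split=> //; split=> [w /zP[/WbP[/WP|]|]|a ab l' l'L l'l]; auto.
  have [S [SB [nS /(_ l' l'L)[w [wS [aw l'w]]]]]] := BP a ab.
  have wT : w ∈ T by apply/TP; exists S; split=> //; apply/B'P.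
  exists w; split=> //; apply/zP; left; apply/WbP; left; apply/WP; split=> //.
  by exists a; do 2!split=> //; exists l'.
have [C CP] := collection
  (R := fun l z => node T z /\ (b ∈ z /\ l ∈ z))
  (p := FAnd (FNode 2 0 4) (FAnd (FMem 3 0) (FMem 1 0)))
  (v := scons T (scons b (fun=> L))) (a := L) (fun _ _ => iff_refl _)
  ltac:(solve_delta0) extend.
have [C' C'P] := separation (P := node T) (p := FNode 1 0 2)
  (v := scons T (fun=> L)) C (fun=> iff_refl _) ltac:(solve_delta0).
have [T' T'P] := binary_union T C'; exists T'; split.
  move=> z zT'; apply: (@node_sub T) => [x xT|]; first by apply/T'P; left.
  by move/T'P: zT' => [/nT|/C'P[]].
move=> l /CP[z [zC [nz ?]]]; exists z; split=> //.
by apply/T'P; right; apply/C'P.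
Qed.

Lemma node_not_ordinal T z : nodes T -> z ∈ T -> ~ ordinal z.
Proof.
move=> nT /nT[_ [_ [_ [l [lz [lL _]]]]]] oz.
exact: L_not_ordinal lL (mem_ordinal oz lz).
Qed.

Lemma node_notin T z : nodes T -> z ∈ T -> ~ z ∈ L.
Proof.
move=> nT /nT[_ [_ [_ [l [lz [lL _]]]]]] zL.
exact: L_not_ordinal lL (L_ordinals zL lz).
Qed.

(** No set is two of ordinal, label and node, so [b] and [l] agree with the witnesses hidden in
    [node T z]. *)
Lemma nodeP T z b l : nodes T -> z ∈ T -> ordinal b -> b ∈ z -> l ∈ L -> l ∈ z ->
  [/\ forall c, ordinal c -> c ∈ z -> c = b,
   forall l', l' ∈ L -> l' ∈ z -> l' = l,
   forall w, w ∈ z -> w = b \/ w = l \/ w ∈ T /\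
       exists a l', [/\ a ∈ w, l' ∈ w, a ∈ b, l' ∈ L & linked l' l] &
   forall a l', a ∈ b -> l' ∈ L -> linked l' l ->
       exists w, [/\ w ∈ z, w ∈ T, a ∈ w & l' ∈ w]].
Proof.
move=> nT zT ob bz lL lz.
have [b0 [b0z [ob0 [l0 [l0z [l0L [zP zE]]]]]]] := nT z zT.
have bE c : ordinal c -> c ∈ z -> c = b0.
  move=> oc /zP[//|[cl|[cT _]]].
    by case: (L_not_ordinal l0L); rewrite -cl.
  by case: (node_not_ordinal nT cT).
have lE k : k ∈ L -> k ∈ z -> k = l0.
  move=> kL /zP[kb|[//|[kT _]]].
    by case: (L_not_ordinal kL); rewrite kb.
  by case: (node_notin nT kT).
rewrite (bE b) // (lE l) //; split=> //.
- move=> w /zP[|[|[wT [a [aw [ab [l' [l'w [l'L l'l]]]]]]]]].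
  + by left.
  + by right; left.
  + by right; right; split=> //; exists a, l'.
- move=> a l' ab l'L l'l; have [w [wz [wT [aw l'w]]]] := zE a ab l' l'L l'l.
  by exists w.
Qed.

(** Induction on [b]: a lower node in z has a counterpart in z' with the same ordinal and label, and
    the hypothesis identifies the two. Thus values taken from different levels agree. *)
Lemma node_unique b : ordinal b -> forall l, l ∈ L -> forall T T' z z',
  nodes T -> nodes T' -> z ∈ T -> z' ∈ T' ->
  b ∈ z -> l ∈ z -> b ∈ z' -> l ∈ z' -> z = z'.
Proof.
move: b; apply: (set_induction (P := fun b =>
   ordinal b -> forall l, l ∈ L -> forall T T' z z',
  nodes T -> nodes T' -> z ∈ T -> z' ∈ T' ->
  b ∈ z -> l ∈ z -> b ∈ z' -> l ∈ z' -> z = z')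
  (p := FImp (FOrd 0) (FAll (FImp (FMem 0 2) (FAll (FAll (FAll (FAll
     (FImp (FNodes 3 6) (FImp (FNodes 2 6) (FImp (FMem 1 3) (FImp (FMem 0 2)
     (FImp (FMem 5 1) (FImp (FMem 4 1) (FImp (FMem 5 0) (FImp (FMem 4 0)
        (FEq 1 0)))))))))))))))) (v := fun=> L)) => // b IH ob l lL.
have sub T T' z z' : nodes T -> nodes T' -> z ∈ T -> z' ∈ T' ->
    b ∈ z -> l ∈ z -> b ∈ z' -> l ∈ z' -> forall w, w ∈ z -> w ∈ z'.
  move=> nT nT' zT zT' bz lz bz' lz' w.
  have [_ _ zP _] := nodeP nT zT ob bz lL lz.
  have [_ _ _ zE'] := nodeP nT' zT' ob bz' lL lz'.
  move=> /zP[->//|[->//|[wT [a [l' [aw l'w ab l'L l'l]]]]]].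
  have [w' [w'z w'T aw' l'w']] := zE' a l' ab l'L l'l.
  by rewrite (IH a ab (mem_ordinal ob ab) l' l'L T T' w w').
move=> T T' z z' nT nT' zT zT' bz lz bz' lz'.
by apply: (KP_extensionality KP) => w; split;
  [exact: (sub T T') | exact: (sub T' T)].
Qed.

(** A node is neither an ordinal nor a label, so it can enter z' only as a lower node; the converse
    uses [node_unique]. *)
Lemma node_mem T T' z z' b l b' l' : nodes T -> nodes T' -> z ∈ T -> z' ∈ T' ->
  ordinal b -> l ∈ L -> ordinal b' -> l' ∈ L ->
  b ∈ z -> l ∈ z -> b' ∈ z' -> l' ∈ z' ->
  (z ∈ z' <-> b ∈ b' /\ linked l l').
Proof.
move=> nT nT' zT zT' ob lL ob' lL' bz lz bz' lz'.
have [zb zl _ _] := nodeP nT zT ob bz lL lz.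
have [_ _ zP' zE'] := nodeP nT' zT' ob' bz' lL' lz'.
split=> [/zP'[zb'|[zl'|[_ [a [k [az kz ab kL kl]]]]]]|[bb ll]].
- by case: (node_not_ordinal nT zT); rewrite zb'.
- by case: (node_notin nT zT); rewrite zl'.
- by rewrite -(zl k) // -(zb a) //; exact: mem_ordinal ab.
- have [w [wz wT bw lw]] := zE' b l bb lL ll.
  by rewrite (node_unique ob lL nT nT' zT wT).
Qed.

Lemma node_function : exists J : M -> M -> M,
  (forall b l b' l', ordinal b -> l ∈ L -> ordinal b' -> l' ∈ L ->
     J b l = J b' l' -> l = l') /\
  forall b l b' l', ordinal b -> l ∈ L -> ordinal b' -> l' ∈ L ->
  (J b l ∈ J b' l' <-> b ∈ b' /\ linked l l').
Proof.
have node_at b l : exists z, ordinal b -> l ∈ L ->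
    exists T, [/\ nodes T, z ∈ T, b ∈ z & l ∈ z].
  have [[ob lL]|nbl] := pselect (ordinal b /\ l ∈ L); last first.
    (* Away from ordinals and labels the value is arbitrary. *)
    by exists b => ob lL; case: nbl.
  have [T [nT /(_ l lL)[z [zT [bz lz]]]]] := level_exists ob.
  by exists z => _ _; exists T.
have [J JP] := choice (fun bl => node_at bl.1 bl.2).
exists (fun b l => J (b, l)).
split=> b l b' l' ob lL ob' l'L => [JE|].
  have [T [nT zT bz lz]] := JP (b, l) ob lL.
  have [T' [_ _ _ l'z]] := JP (b', l') ob' l'L.
  have [_ zl _ _] := nodeP nT zT ob bz lL lz.
  by rewrite (zl l') // JE.
have [T [nT zT bz lz]] := JP (b, l) ob lL.
have [T' [nT' zT' bz' lz']] := JP (b', l') ob' l'L.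
exact: (node_mem nT nT' zT zT').
Qed.

End Nodes.

End KP.

(** * Embedding a model with ranks in the natural numbers *)

(** By extensionality, a set of rank at most n is determined by the listed sets of rank below n that
    it contains, so subsets of [T] index the next stage. *)
Lemma finite_sublevel (M : Type) (E : M -> M -> Prop) (r : M -> nat) (x0 : M) :
  (forall a b, (forall x, E x a <-> E x b) -> a = b) ->
  (forall x y, E x y -> r x < r y) ->
  forall n, exists (T : finType) (e : T -> M),
    forall x, r x < n -> exists t, x = e t.
Proof.
move=> ext rE; elim=> [|n [T [e eP]]]; first by exists bool, (fun=> x0).
pose code x := [set t | `[< E (e t) x >]]%SET.
have dec (D : {set T}) : exists y, forall x, r x < n.+1 -> code x = D -> x = y.
  have [[y [ry yD]]|nD] := pselect (exists y, r y < n.+1 /\ code y = D).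
    exists y => x rx xD; apply: ext => z.
    have rz w : r w < n.+1 -> E z w -> exists t, z = e t.
      by move=> rw /rE zw; apply: eP; exact: leq_trans zw rw.
    have EP w t : E (e t) w <-> t \in code w.
      by rewrite inE; split=> [?|/asboolP//]; exact/asboolP.
    by split=> [/[dup] /(rz _ rx)[t ->]|/[dup] /(rz _ ry)[t ->]] /EP tw;
      apply/EP; rewrite ?yD -?xD // xD -yD.
  by exists x0 => x rx xD; case: nD; exists x.
have [d dP] := choice dec; exists {set T}, d => x rx.
by exists (code x); exact: dP.
Qed.

Lemma finite_range_set (N : Type) (E : N -> N -> Prop) (KP : KP_model E)
    (T : finType) (D : T -> Prop) (h : T -> N) :
  exists c, forall z, E z c <-> exists t, D t /\ z = h t.
Proof.
suff [c cP] : exists c, forall z, E z c <-> exists t, t \in enum T /\ D t /\ z = h t.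
  exists c => z; rewrite cP; split=> [[t [_ ?]]|[t ?]]; exists t => //.
  by rewrite mem_enum.
elim: (enum T) => [|a s [c cP]].
  by have [c c0] := empty_set KP; exists c => z; split=> [/c0//|[t []]].
have [Da|nDa] := pselect (D a); last first.
  exists c => z; rewrite cP; split=> [[t [ts ?]]|[t [+ [Dt zt]]]].
    by exists t; rewrite inE ts orbT.
  by rewrite inE => /orP[/eqP ta|ts]; [rewrite ta in Dt | exists t].
have [c' c'P] := adjunction KP c (h a); exists c' => z; rewrite c'P cP.
split=> [[[t [ts ?]]|->]|[t [+ [Dt zt]]]].
- by exists t; rewrite inE ts orbT.
- by exists a; rewrite mem_head.
- by rewrite inE => /orP[/eqP <-|ts]; [right | left; exists t].
Qed.

(** The embedding is j(x) = {j(y) : y in x}; this set exists in N because x has finitely many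
    elements. *)
Lemma embeds_of_nat_rank (M N : Type) (memM : M -> M -> Prop)
    (memN : N -> N -> Prop) (hM : KP_model memM) (hN : KP_model memN)
    (r : M -> nat) :
  (forall x y, memM x y -> r x < r y) -> embeds memM memN.
Proof.
move=> rE; have [x0] := KP_nonempty hM.
have fin := finite_sublevel x0 (KP_extensionality hM) rE.
have image_set (xh : M * (M -> N)) :
    exists c, forall z, memN z c <-> exists y, memM y xh.1 /\ z = xh.2 y.
  case: xh => x h /=; have [T [e eP]] := fin (r x).
  have [c cP] := finite_range_set hN (fun t => memM (e t) x) (fun t => h (e t)).
  exists c => z; rewrite cP; split=> [[t [ex ->]]|[y [yx ->]]]; first by exists (e t).
  by have [t yt] := eP y (rE _ _ yx); exists t; rewrite -yt.
have [F FP] := choice image_set.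
have [y0] := KP_nonempty hN.
have [J JS] : exists J : nat -> M -> N, forall n x, J n.+1 x = F (x, J n).
  by exists (fun n => iter n (fun h x => F (x, h)) (fun=> y0)).
have J_stable n m x : r x < n -> r x < m -> J n x = J m x.
  elim: n m x => [//|n IH] [//|m] x rn rm.
  apply: (KP_extensionality hN) => z; rewrite !JS !FP /=.
  have JE y : memM y x -> J n y = J m y.
    by move=> /rE yx; apply: IH; exact: leq_trans yx _.
  by split=> -[y [yx ->]]; exists y; rewrite JE.
(* By [J_stable], all stages beyond [r x] agree at [x]; this is the first. *)
pose j x := J (r x).+1 x.
have jP x z : memN z (j x) <-> exists y, memM y x /\ z = j y.
  rewrite /j JS FP /=; split=> -[y [yx ->]]; exists y; split=> //;
    by apply: J_stable => //; exact: rE.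
have j_inj n x y : r x < n -> j x = j y -> x = y.
  elim: n x y => // n IH x y rx jxy; apply: (KP_extensionality hM) => z.
  split=> zx.
    have /jP[w [wy zw]] : memN (j z) (j y) by rewrite -jxy; apply/jP; exists z.
    by rewrite (IH z w) //; exact: leq_trans (rE _ _ zx) _.
  have /jP[w [wx zw]] : memN (j z) (j x) by rewrite jxy; apply/jP; exists z.
  by rewrite -(IH w z) //; exact: leq_trans (rE _ _ wx) _.
exists j; split=> [x y|x y]; first exact: (j_inj (r x).+1).
split=> [xy|/jP[z [zy /(j_inj (r x).+1 _ _ (ltnSn _))->//]]].
by apply/jP; exists x.
Qed.

(** * Embedding by labels when an ordinal of N contains all numerals *)

Lemma embeds_of_infinite_ordinal (M N : Type) (memM : M -> M -> Prop)
    (memN : N -> N -> Prop) (hM : KP_model memM) (hN : KP_model memN)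
    (e : M -> nat) (g : M -> N) (num : nat -> N) (n : N) :
  injective e -> (forall x, ordinal memN (g x)) ->
  (forall x y, memM x y -> memN (g x) (g y)) ->
  (forall x, ~ memN x (num 0)) ->
  (forall i x, memN x (num i.+1) <-> memN x (num i) \/ x = num i) ->
  ordinal memN n -> (forall i, memN (num i) n) ->
  embeds memM memN.
Proof.
move=> e_inj og gE num0 numS on nn.
have lt := num_lt hN num0 numS; have ninj := num_inj hN num0 numS.
have onum := num_ordinal num0 numS.
have [U UP] := finite_subsets_cover hN num0 numS on nn.
(* Labels are nonempty sets of nonempty ordinals. A nonempty ordinal contains the empty set, so no
   ordinal is a label. *)
have [L LP] := separation hN (P := fun s => (exists t, memN t s /\ t = t) /\
    forall t, memN t s -> ordinal memN t /\ exists u, memN u t /\ u = u)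
  (p := FAnd (FBex 0 (FEq 0 0))
     (FBall 0 (FAnd (FOrd 0) (FBex 0 (FEq 0 0))))) (v := fun=> n) U
  (fun=> iff_refl _) ltac:(solve_delta0).
have L_ord l t : memN l L -> memN t l -> ordinal memN t.
  by move=> /LP[_ [_ lP]] /lP[].
have L_not_ord l : memN l L -> ~ ordinal memN l.
  move=> /LP[_ [[t [tl _]] lP]] ol.
  have [l0|/lP[_ [u [/num0//]]]] := ordinal_empty_mem hN num0 ol.
  by rewrite l0 in tl; case: (num0 _ tl).
have [J [J_inj JP]] := node_function hN L_not_ord L_ord.
pose adj x y := memM x y \/ memM y x.
(* The shift by one keeps zero out of the labels. *)
pose D x i := exists k, i = k.+1 /\
  (k = e x \/ k < e x /\ exists y, e y = k /\ adj y x).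
have label x : exists s, memN s L /\ forall t, memN t s <->
    exists i, D x i /\ t = num i.
  have [s [sU sP]] := UP (e x).+2 (D x).
  have sE t : memN t s <-> exists i, D x i /\ t = num i.
    rewrite sP; split=> [[i [_ ?]]|[i [Di ?]]]; exists i => //; split=> //.
    have [k [-> [->//|[kx _]]]] := Di.
    by rewrite ltnS; exact: ltnW.
  exists s; split=> //; apply/LP; split=> //; split.
    exists (num (e x).+1); split=> //; apply/sE; exists (e x).+1; split=> //.
    by exists (e x); split=> //; left.
  move=> t /sE[i [[k [-> _]] ->]]; split; first exact: onum.
  by exists (num k); split=> //; exact/lt.
have [l lP] := choice label.
have lL x : memN (l x) L by case: (lP x).
have mem_l x t : memN t (l x) <-> exists i, D x i /\ t = num i.
  by case: (lP x).
have own x : memN (num (e x).+1) (l x).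
  by apply/mem_l; exists (e x).+1; split=> //; exists (e x); split=> //; left.
have le_own x i : memN (num i) (l x) -> i <= (e x).+1.
  move=> /mem_l[k [[m [-> mx]] /ninj->]]; rewrite ltnS.
  by case: mx => [->//|[/ltnW]].
have top_own x i : memN i (l x) -> top memN (l x) i -> i = num (e x).+1.
  move=> ix ti; have /mem_l[k [_ ik]] := ix; rewrite ik in ix ti *.
  have [//|/lt xi] := ti _ (own x).
  by have := le_own _ _ ix; rewrite leqNgt xi.
have own_top x : top memN (l x) (num (e x).+1).
  move=> k kx; have /mem_l[i [_ ki]] := kx; rewrite ki in kx *.
  have := le_own _ _ kx; rewrite leq_eqVlt => /orP[/eqP->|]; first by left.
  by move=> ?; right; apply/lt.
have mem_own x y : e x != e y -> memN (num (e x).+1) (l y) <->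
    e x < e y /\ adj x y.
  move=> exy; rewrite mem_l; split=> [[i [[k [-> ky]] /ninj[kx]]]|[xy a]].
    subst k; case: ky => [/eqP|[? [z [/e_inj-> ?]]]] //.
    by rewrite (negbTE exy).
  by exists (e x).+1; split=> //; exists (e x); split=> //; right; split=> //; exists x.
have linkedP x y : x <> y -> linked memN (l x) (l y) <-> adj x y.
  move=> xy; have exy : e x != e y by apply/eqP => /e_inj.
  have eyx : e y != e x by rewrite eq_sym.
  split=> [[i [ix [iy [ti|ti]]]]|a].
  - by move: iy; rewrite (top_own x i) // => /mem_own[].
  - by move: ix; rewrite (top_own y i) // => /mem_own[//|_]; rewrite /adj; tauto.
  (* The greatest element of the label with the smaller code lies in the other label. *)
  have [lxy|lyx] : e x < e y \/ e y < e x by apply/orP; rewrite -neq_ltn.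
    exists (num (e x).+1); split=> //; split; last by left.
    exact/mem_own.
  exists (num (e y).+1); split; last by split=> //; right.
  by apply/mem_own => //; split=> //; move: a; rewrite /adj; tauto.
exists (fun x => J (g x) (l x)); split=> x y.
  move=> /(J_inj _ _ _ _ (og x) (lL x) (og y) (lL y)) lxy; apply: e_inj.
  (* Equal labels have equal greatest elements, which determine [e]. *)
  have := top_own y (num (e x).+1); rewrite -lxy => /(_ (own x) (own_top x)).
  by move=> /ninj[].
rewrite JP //; split=> [xy|[gxy lxy]].
  split; first exact: gE.
  by apply/linkedP; [move=> yx; case: (mem_irrefl hM (a := y)); rewrite -{1}yx | left].
(* Every [l x] is linked to itself, so x = y is first refuted by irreflexivity in N; otherwise [g]
   gives the direction of the link. *)
have [xy|/linkedP linkE] := pselect (x = y).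
  by case: (@mem_irrefl _ _ hN (g x)); rewrite {2}xy.
by have [//|/gE /(mem_asym hN gxy)] := linkE.1 lxy.
Qed.

(** * The equivalence, by ranks and a case split on the numerals *)

Theorem corollary28 (M N : Type) (memM : M -> M -> Prop)
    (memN : N -> N -> Prop)
    (hM : KP_model memM) (hN : KP_model memN)
    (hcountable : countable [set: M]) :
  embeds memM memN <->
  exists f : Ord memM -> Ord memN,
    forall a b : Ord memM, ord_lt a b -> ord_lt (f a) (f b).
Proof.
split=> [[j [j_inj jE]]|[f fE]].
  have [rk [ork rkE]] := rank_exists hN.
  exists (fun a => exist _ (rk (j (sval a))) ((ordinalP _ _).2 (ork _))).
  by move=> a b ab; apply: rkE; apply/jE.
have [rk [ork rkE]] := rank_exists hM.
pose g x := sval (f (exist _ (rk x) ((ordinalP _ _).2 (ork x)))).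
have og x : ordinal memN (g x) by apply/ordinalP; rewrite /g; case: (f _).
have gE x y : memM x y -> memN (g x) (g y) by move=> xy; apply: fE; exact: rkE.
have [num [num0 numS]] := numerals_exist hN.
have [[x gx]|fin] := pselect (exists x, forall i, memN (num i) (g x)).
  have /pcard_leTP[e] := hcountable.
  exact: (embeds_of_infinite_ordinal hM hN (e := e) _ og gE num0 numS (og x) gx).
(* Every [g x] is now a numeral, whose index serves as a rank in the natural numbers. *)
have r_exists x : exists i, g x = num i.
  have [//|inf] := ordinal_num_or hN num0 numS (og x).
  by case: fin; exists x.
have [r rP] := choice r_exists.
apply: (embeds_of_nat_rank hM hN (r := r)) => x y /gE.
by rewrite !rP; exact: (num_lt hN num0 numS _ _).1.
Qed.
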